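(* Let $\mathcal A$ and $\mathcal B$ be two commutative Fréchet algebras. Then $$\mathcal M(\mathcal A\oplus\mathcal B)=\mathcal M(\mathcal A)\times\mathcal M(\mathcal B),$$ where a pair $(\Phi,\Psi)$ of functions $\Phi:\Delta(\mathcal A)\to\mathbb C$ and $\Psi:\Delta(\mathcal B)\to\mathbb C$ is identified with the function on $\Delta(\mathcal A\oplus\mathcal B)$ given by $(\varphi,0)\mapsto\Phi(\varphi)$ for $\varphi\in\Delta(\mathcal A)$ and $(0,\psi)\mapsto\Psi(\psi)$ for $\psi\in\Delta(\mathcal B)$.
   Context: A Fréchet algebra is a complete metrizable (Hausdorff) topological algebra over $\mathbb C$ whose topology is generated by a countable increasing family of submultiplicative seminorms. For a commutative Fréchet algebra $\mathcal C$, $\Delta(\mathcal C)$ is the set of all nonzero continuous multiplicative linear functionals $\mathcal C\to\mathbb C$, with the Gelfand topology (topology of pointwise convergence on $\mathcal C$). For $a\in\mathcal C$, $\widehat a:\Delta(\mathcal C)\to\mathbb C$ is $\widehat a(\varphi)=\varphi(a)$, and $\widehat{\mathcal C}=\{\widehat a:a\in\mathcal C\}$. Define $\mathcal M(\mathcal C)=\{\Phi:\Delta(\mathcal C)\to\mathbb C:\ \Phi\text{ is continuous and }\Phi\cdot\widehat{\mathcal C}\subseteq\widehat{\mathcal C}\}$ (pointwise product). Direct sum: if the topologies of $\mathcal A,\mathcal B$ are given by increasing submultiplicative seminorms $(r_\ell)_{\ell\in\mathbb N}$, $(s_\ell)_{\ell\in\mathbb N}$, then $\mathcal A\oplus\mathcal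 B=\mathcal A\times\mathcal B$ with coordinatewise linear operations and multiplication, and seminorms $P_\ell(a,b)=r_\ell(a)+s_\ell(b)$; this is a commutative Fréchet algebra. One has $(\mathcal A\oplus\mathcal B)^*=\mathcal A^*\oplus\mathcal B^*$ via $(f,g)(a,b)=f(a)+g(b)$, and with this notation $\Delta(\mathcal A\oplus\mathcal B)=(\Delta(\mathcal A)\times\{0\})\cup(\{0\}\times\Delta(\mathcal B))$. *)

(* Defs.v *)
From HB Require Import structures.
From mathcomp Require Import all_boot all_order all_algebra.
From mathcomp Require Import complex.
From mathcomp Require Import all_classical all_reals all_analysis.

Set Implicit Arguments.
Unset Strict Implicit.
Unset Printing Implicit Defensive.

Import Order.TTheory GRing.Theory Num.Theory.

Local Open Scope classical_set_scope.
Local Open Scope ring_scope.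

(* The complex numbers as a topological vector space over themselves. *)
Notation Cplx R := (R[i]^o) (only parsing).

(* Algebras are not assumed to have a unit, so MathComp's [algType], whose
   objects are unital rings, is not applicable. *)
HB.mixin Record Lmodule_isNonUnitalAlgebra (K : pzRingType) V
    & GRing.Lmodule K V := {
  amul : V -> V -> V ;
  amulA : associative amul ;
  amulDl : left_distributive amul +%R ;
  amulDr : right_distributive amul +%R ;
  amulZl : forall (c : K) (x y : V), amul (c *: x) y = c *: amul x y ;
  amulZr : forall (c : K) (x y : V), amul x (c *: y) = c *: amul x y
}.

#[short(type="nonUnitalAlgType")]
HB.structure Definition NonUnitalAlgebra (K : pzRingType) :=
  {V of GRing.Lmodule K V & Lmodule_isNonUnitalAlgebra K V}.

(* [nbhs] and [cauchy] in [V] both come from its uniformity, so that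
   [entourage_fsnormE] determines topology and completeness alike.
   Since the seminorms increase, the sets [{(x, y) | p_l (x - y) < e}] form a
   base (and not only a subbase) of the translation-invariant uniformity they
   generate. Continuity of the product follows from submultiplicativity. *)
HB.mixin Record isFrechetAlgebra (R : realType) V
    & NonUnitalAlgebra R[i] V & Tvs R[i] V := {
  fsnorm : nat -> V -> R ;
  fsnorm_ge0 : forall l x, 0 <= fsnorm l x ;
  fsnormD : forall l x y, fsnorm l (x + y) <= fsnorm l x + fsnorm l y ;
  fsnormZ : forall l (c : R[i]) x, fsnorm l (c *: x) = Normc.normc c * fsnorm l x ;
  fsnormM : forall l x y, fsnorm l (amul x y) <= fsnorm l x * fsnorm l y ;
  fsnorm_incr : forall l x, fsnorm l x <= fsnorm l.+1 x ;
  entourage_fsnormE : forall E : set (V * V), entourage E <->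
    exists l (e : R), 0 < e /\ forall x y, fsnorm l (x - y) < e -> E (x, y) ;
  frechet_hausdorff : hausdorff_space V ;
  frechet_complete : forall F : set_system V, ProperFilter F -> cauchy F ->
    exists x : V, F --> x
}.

#[short(type="frechetAlgType")]
HB.structure Definition FrechetAlgebra (R : realType) :=
  {V of NonUnitalAlgebra R[i] V & Tvs R[i] V & isFrechetAlgebra R V}.

HB.mixin Record isComFrechetAlgebra (R : realType) V & FrechetAlgebra R V := {
  amulC : commutative (amul : V -> V -> V)
}.

#[short(type="comFrechetAlgType")]
HB.structure Definition ComFrechetAlgebra (R : realType) :=
  {V of FrechetAlgebra R V & isComFrechetAlgebra R V}.

Section direct_sum_algebra.
Context (K : pzRingType) (A B : nonUnitalAlgType K).
Implicit Types x y z : (A * B)%type.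

Definition pair_amul x y : (A * B)%type := (amul x.1 y.1, amul x.2 y.2).

Fact pair_amulA : associative pair_amul.
Proof. by move=> x y z; rewrite /pair_amul /= !amulA. Qed.

Fact pair_amulDl : left_distributive pair_amul +%R.
Proof. by move=> x y z; rewrite /pair_amul /= !amulDl. Qed.

Fact pair_amulDr : right_distributive pair_amul +%R.
Proof. by move=> x y z; rewrite /pair_amul /= !amulDr. Qed.

Fact pair_amulZl (c : K) x y : pair_amul (c *: x) y = c *: pair_amul x y.
Proof. by rewrite /pair_amul /= !amulZl. Qed.

Fact pair_amulZr (c : K) x y : pair_amul x (c *: y) = c *: pair_amul x y.
Proof. by rewrite /pair_amul /= !amulZr. Qed.

HB.instance Definition _ := Lmodule_isNonUnitalAlgebra.Build K (A * B)%type
  pair_amulA pair_amulDl pair_amulDr pair_amulZl pair_amulZr.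

End direct_sum_algebra.

Lemma hausdorff_prod (T U : topologicalType) :
  hausdorff_space T -> hausdorff_space U -> hausdorff_space (T * U)%type.
Proof.
move=> hT hU [p1 p2] [q1 q2] pq; congr (_, _).
- apply: hT => X Y nX nY.
  have [||[z1 z2] [/= zX zY]] := pq (X `*` setT) (Y `*` setT).
  + by exists (X, setT) => //; split => //; exact: filterT.
  + by exists (Y, setT) => //; split => //; exact: filterT.
  + by exists z1; split; [case: zX|case: zY].
- apply: hU => X Y nX nY.
  have [||[z1 z2] [/= zX zY]] := pq (setT `*` X) (setT `*` Y).
  + by exists (setT, X) => //; split => //; exact: filterT.
  + by exists (setT, Y) => //; split => //; exact: filterT.
  + by exists z2; split; [case: zX|case: zY].
Qed.

Lemma prod_complete (T U : uniformType) :
  (forall F : set_system T, ProperFilter F -> cauchy F -> exists x : T, F --> x) ->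
  (forall F : set_system U, ProperFilter F -> cauchy F -> exists x : U, F --> x) ->
  forall F : set_system (T * U)%type, ProperFilter F -> cauchy F ->
    exists x : (T * U)%type, F --> x.
Proof.
move=> cT cU F FF cF.
have c1 : cauchy (fst @ F).
  move=> E entE.
  have /cF [[X Y] [/= FX FY] XYE] := prod_entP entE (@entourageT U).
  exists (fst @` X, fst @` Y).
    split => /=; rewrite /nbhs /=.
      by apply: (@filterS _ F _ X) => // z Xz; exists z.
    by apply: (@filterS _ F _ Y) => // z Yz; exists z.
  move=> [_ _] [/= [x Xx <-] [y Yy <-]].
  by have [] := XYE (x, y) (conj Xx Yy).
have c2 : cauchy (snd @ F).
  move=> E entE.
  have /cF [[X Y] [/= FX FY] XYE] := prod_entP (@entourageT T) entE.
  exists (snd @` X, snd @` Y).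
    split => /=; rewrite /nbhs /=.
      by apply: (@filterS _ F _ X) => // z Xz; exists z.
    by apply: (@filterS _ F _ Y) => // z Yz; exists z.
  move=> [_ _] [/= [x Xx <-] [y Yy <-]].
  by have [] := XYE (x, y) (conj Xx Yy).
have [x l1] := cT _ _ c1; have [y l2] := cU _ _ c2.
exists (x, y) => X [[P Q] [/= /l1 FP /l2 FQ] PQX].
exact: (@filterS _ F _ _ X PQX (filterI (FP : F (fst @^-1` P)) (FQ : F (snd @^-1` Q)))).
Qed.

Section direct_sum_frechet.
Context (R : realType) (A B : frechetAlgType R).
Implicit Types x y : (A * B)%type.

Definition pair_fsnorm (l : nat) x : R := fsnorm l x.1 + fsnorm l x.2.

Fact pair_fsnorm_ge0 l x : 0 <= pair_fsnorm l x.
Proof. by rewrite addr_ge0// fsnorm_ge0. Qed.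

Fact pair_fsnormD l x y :
  pair_fsnorm l (x + y) <= pair_fsnorm l x + pair_fsnorm l y.
Proof. by rewrite /pair_fsnorm addrACA lerD// fsnormD. Qed.

Fact pair_fsnormZ l (c : R[i]) x :
  pair_fsnorm l (c *: x) = Normc.normc c * pair_fsnorm l x.
Proof. by rewrite /pair_fsnorm /= !fsnormZ mulrDr. Qed.

Fact pair_fsnormM l x y :
  pair_fsnorm l (amul x y) <= pair_fsnorm l x * pair_fsnorm l y.
Proof.
rewrite /pair_fsnorm mulrDl; apply: lerD; apply: (le_trans (fsnormM _ _ _)).
  by rewrite ler_wpM2l ?fsnorm_ge0// lerDl fsnorm_ge0.
by rewrite ler_wpM2l ?fsnorm_ge0// lerDr fsnorm_ge0.
Qed.

Fact pair_fsnorm_incr l x : pair_fsnorm l x <= pair_fsnorm l.+1 x.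
Proof. by rewrite lerD// fsnorm_incr. Qed.

Lemma fsnorm_homo (V : frechetAlgType R) (x : V) :
  {homo (fun l => fsnorm l x) : l m / (l <= m)%N >-> l <= m}.
Proof. by apply: homo_leq => // [? ? ? /le_trans|l]; [exact|exact: fsnorm_incr]. Qed.

Fact pair_entourage_fsnormE (E : set ((A * B) * (A * B))) : entourage E <->
  exists l (e : R), 0 < e /\ forall x y, pair_fsnorm l (x - y) < e -> E (x, y).
Proof.
split=> [[[/= EA EB] [/entourage_fsnormE [l [e [e0 lE]]]
    /entourage_fsnormE [m [d [d0 mE]]]] EE]|[l [e [e0 lE]]]].
  exists (maxn l m), (Num.min e d); split; first by rewrite lt_min e0.
  move=> [x1 x2] [y1 y2]; rewrite /pair_fsnorm lt_min /= => /andP[xe xd].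
  have xyE : (EA `*` EB) ((x1, y1), (x2, y2)).
    split.
      apply: lE; apply: le_lt_trans xe; apply: (le_trans (fsnorm_homo _ (leq_maxl l m))).
      by rewrite lerDl fsnorm_ge0.
    apply: mE; apply: le_lt_trans xd; apply: (le_trans (fsnorm_homo _ (leq_maxr l m))).
    by rewrite lerDr fsnorm_ge0.
  by have [[[u1 u2] [v1 v2]] /= Euv [<- <- <- <-]] := EE _ xyE.
have e20 : 0 < e / 2 by rewrite divr_gt0.
have EA : entourage [set xy : A * A | fsnorm l (xy.1 - xy.2) < e / 2].
  by apply/entourage_fsnormE; exists l, (e / 2).
have EB : entourage [set xy : B * B | fsnorm l (xy.1 - xy.2) < e / 2].
  by apply/entourage_fsnormE; exists l, (e / 2).
apply: filterS (prod_entP EA EB) => -[x y] /= [xye xye'].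
by apply: lE; rewrite /pair_fsnorm (splitr e) ltrD.
Qed.

HB.instance Definition _ := isFrechetAlgebra.Build R (A * B)%type
  pair_fsnorm_ge0 pair_fsnormD pair_fsnormZ pair_fsnormM pair_fsnorm_incr
  pair_entourage_fsnormE
  (hausdorff_prod (@frechet_hausdorff R A) (@frechet_hausdorff R B))
  (prod_complete (@frechet_complete R A) (@frechet_complete R B)).

End direct_sum_frechet.

Section direct_sum_com.
Context (R : realType) (A B : comFrechetAlgType R).

Fact pair_amulC : commutative (amul : (A * B) -> (A * B) -> (A * B)).
Proof. by move=> x y; congr (_, _); exact: amulC. Qed.

HB.instance Definition _ := isComFrechetAlgebra.Build R (A * B)%type pair_amulC.

End direct_sum_com.

Definition direct_sum (R : realType) (A B : comFrechetAlgType R) :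
  comFrechetAlgType R := (A * B)%type.

Notation "A ⊕ B" := (direct_sum A B) (at level 50, left associativity).

Section gelfand.
Context (R : realType) (A : comFrechetAlgType R).

(* The ambient type carries the topology of pointwise convergence on [A]. *)
Definition characters : set {ptws A -> Cplx R} :=
  [set phi | [/\ linear (phi : A -> Cplx R),
                 {morph (phi : A -> Cplx R) : x y / amul x y >-> (x * y : R[i])},
                 continuous (phi : A -> Cplx R) &
                 exists a, phi a != 0]].

(* [set_type] carries the subspace topology, which is here the Gelfand topology. *)
Definition Delta : topologicalType := set_type characters.

Definition gelfand (a : A) : Delta -> Cplx R := fun phi => \val phi a.

Definition multipliers : set (Delta -> Cplx R) :=
  [set Phi : Delta -> Cplx R | continuous Phi /\
    [set Phi \* f | f in range gelfand] `<=` range gelfand].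

End gelfand.
Arguments characters {R} A.
Arguments Delta {R} A.
Arguments multipliers {R} A.

Section spectrum_direct_sum.
Context (R : realType) (A B : comFrechetAlgType R).

(* The functional on [A ⊕ B] denoted by the pair [(f, g)]. *)
Definition pair_functional (f : A -> Cplx R) (g : B -> Cplx R) :
  A ⊕ B -> Cplx R := fun x => f x.1 + g x.2.

Fact character_inl (phi : Delta A) :
  pair_functional (\val phi) (fun=> 0) \in characters (A ⊕ B).
Proof.
case: phi => /= phi; rewrite !inE => -[lphi mphi cphi [a a0]].
split.
- by move=> c x y; rewrite /pair_functional !addr0 /= lphi.
- by move=> x y; rewrite /pair_functional !addr0 /= mphi.
- rewrite (_ : pair_functional _ _ = (phi : A -> Cplx R) \o fst); last first.
    by apply/funext => x; rewrite /pair_functional addr0.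
  by move=> x; apply: continuous_comp; [exact: cvg_fst|exact: cphi].
- by exists (a, 0); rewrite /pair_functional addr0.
Qed.

Fact character_inr (psi : Delta B) :
  pair_functional (fun=> 0) (\val psi) \in characters (A ⊕ B).
Proof.
case: psi => /= psi; rewrite !inE => -[lpsi mpsi cpsi [a a0]].
split.
- by move=> c x y; rewrite /pair_functional !add0r /= lpsi.
- by move=> x y; rewrite /pair_functional !add0r /= mpsi.
- rewrite (_ : pair_functional _ _ = (psi : B -> Cplx R) \o snd); last first.
    by apply/funext => x; rewrite /pair_functional add0r.
  by move=> x; apply: continuous_comp; [exact: cvg_snd|exact: cpsi].
- by exists (0, a); rewrite /pair_functional add0r.
Qed.

Definition Delta_inl (phi : Delta A) : Delta (A ⊕ B) :=
  exist (fun f => f \in characters (A ⊕ B)) _ (character_inl phi).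

Definition Delta_inr (psi : Delta B) : Delta (A ⊕ B) :=
  exist (fun f => f \in characters (A ⊕ B)) _ (character_inr psi).

Lemma Delta_inl_inj : injective Delta_inl.
Proof.
move=> f g /(congr1 val) /= fg; apply: val_inj; apply/funext => a.
by have := congr1 (@^~ (a, 0 : B)) fg; rewrite /pair_functional /= !addr0.
Qed.

Lemma Delta_inr_inj : injective Delta_inr.
Proof.
move=> f g /(congr1 val) /= fg; apply: val_inj; apply/funext => b.
by have := congr1 (@^~ (0 : A, b)) fg; rewrite /pair_functional /= !add0r.
Qed.

Lemma character0 (V : comFrechetAlgType R) (f : Delta V) : \val f 0 = 0.
Proof.
case: f => /= f; rewrite inE => -[lf _ _ _].
by have := lf (-1) 0 0; rewrite scaler0 addr0 scaleN1r addNr.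
Qed.

Lemma Delta_inl_neq_inr phi psi : Delta_inl phi <> Delta_inr psi.
Proof.
move=> /(congr1 val) /= fg; have := valP phi; rewrite inE => -[_ _ _ [a]].
have := congr1 (@^~ (a, 0 : B)) fg.
by rewrite /pair_functional /= addr0 add0r character0 => ->; rewrite eqxx.
Qed.

Lemma Delta_direct_sum (chi : Delta (A ⊕ B)) :
  (exists phi, chi = Delta_inl phi) \/ (exists psi, chi = Delta_inr psi).
Proof.
case: chi => chi chiP; have := chiP; rewrite inE => -[lchi mchi cchi [[a b] ab0]].
have chi0 : chi 0 = 0 by have := lchi (-1) 0 0; rewrite scaler0 addr0 scaleN1r addNr.
have chiD (x : A) (y : B) : chi (x, y) = chi (x, 0) + chi (0, y).
  have := lchi 1 (x, 0) (0, y); rewrite !scale1r => <-.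
  by congr chi; congr (_, _); rewrite /= ?addr0 ?add0r.
have amul0 (V : comFrechetAlgType R) (x : V) : amul x 0 = 0.
  by have := amulZr 0 x 0; rewrite !scale0r.
have chi_or (x : A) (y : B) : chi (x, 0) * chi (0, y) = 0 :> R[i].
  rewrite -mchi -[RHS]chi0; congr chi.
  by congr (_, _); rewrite /= ?amul0// amulC amul0.
have [[x x0]|/forallNP xN] := pselect (exists x : A, chi (x, 0) <> 0); [left|right].
  have chir y : chi (0, y) = 0.
    by have /eqP := chi_or x y; rewrite mulf_eq0 => /orP[/eqP|/eqP].
  have phiP : (fun x : A => chi (x, 0)) \in characters A.
    rewrite inE; split.
    - move=> c u v; rewrite -lchi; congr chi.
      by congr (_, _); rewrite /= scaler0 addr0.
    - move=> u v; rewrite -mchi; congr chi.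
      by congr (_, _); rewrite /= amul0.
    - move=> u; apply: (@continuous_comp A (A ⊕ B) _ (fun u => (u, 0)) chi).
        by apply: cvg_pair; [exact: cvg_id|exact: cvg_cst].
      exact: cchi.
    - by exists x; exact/eqP.
  exists (exist (fun f => f \in characters A) _ phiP); apply: val_inj => /=; apply/funext => -[u v].
  by rewrite /pair_functional /= addr0 chiD chir addr0.
have chil u : chi (u, 0) = 0 by have /contrapT := xN u.
have psiP : (fun y : B => chi (0, y)) \in characters B.
  rewrite inE; split.
  - move=> c u v; rewrite -lchi; congr chi.
    by congr (_, _); rewrite /= scaler0 addr0.
  - move=> u v; rewrite -mchi; congr chi.
    by congr (_, _); rewrite /= amul0.
  - move=> u; apply: (@continuous_comp B (A ⊕ B) _ (fun u => (0, u)) chi).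
      by apply: cvg_pair; [exact: cvg_cst|exact: cvg_id].
    exact: cchi.
  - by exists b; move: ab0; rewrite chiD chil add0r.
exists (exist (fun f => f \in characters B) _ psiP); apply: val_inj => /=; apply/funext => -[u v].
by rewrite /pair_functional /= add0r chiD chil add0r.
Qed.

Lemma Delta_direct_sumP (chi : Delta (A ⊕ B)) : exists s : Delta A + Delta B,
  chi = match s with inl phi => Delta_inl phi | inr psi => Delta_inr psi end.
Proof.
by have [[f ->]|[f ->]] := Delta_direct_sum chi; [exists (inl f)|exists (inr f)].
Qed.

(* The identification of pairs of functions on [Delta A] and [Delta B] with
   functions on [Delta (A ⊕ B)]; it is characterized by [pairing_inl], [pairing_inr]
   and is one-to-one by [pairing_bij]. *)
Definition pairing (F : (Delta A -> Cplx R) * (Delta B -> Cplx R)) :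
    Delta (A ⊕ B) -> Cplx R := fun chi =>
  match projT1 (cid (Delta_direct_sumP chi)) with
  | inl phi => F.1 phi
  | inr psi => F.2 psi
  end.

Lemma pairing_inl F phi : pairing F (Delta_inl phi) = F.1 phi.
Proof.
rewrite /pairing; case: cid => -[phi' /= /Delta_inl_inj ->//|psi /=].
by move=> /Delta_inl_neq_inr.
Qed.

Lemma pairing_inr F psi : pairing F (Delta_inr psi) = F.2 psi.
Proof.
rewrite /pairing; case: cid => -[phi /= /esym|psi' /= /Delta_inr_inj ->//].
by move=> /Delta_inl_neq_inr.
Qed.

Lemma pairing_bij : bijective pairing.
Proof.
exists (fun G => (G \o Delta_inl, G \o Delta_inr)) => [[Phi Psi]|G].
  by congr (_, _); apply/funext => f /=; rewrite ?pairing_inl ?pairing_inr.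
apply/funext => chi.
by have [[f ->]|[f ->]] := Delta_direct_sum chi; rewrite ?pairing_inl ?pairing_inr.
Qed.

End spectrum_direct_sum.

(* Main.v *)
(** [Delta (A ⊕ B)] is the topological disjoint union of [Delta A] and
    [Delta B]: the embedding of [Delta A] is continuous because the topologies
    are those of pointwise convergence, and it is open because its image is the
    set of characters that do not vanish identically on [A × 0] and its inverse
    is restriction to [A × 0]. Hence continuity can be tested on the two
    pieces, and so can the multiplier condition, by evaluating the identity
    [Phi * (a, b)^ = (c, d)^] on each piece. *)
Require Import Defs.
From mathcomp Require Import all_boot all_order all_algebra.
From mathcomp Require Import complex.
From mathcomp Require Import all_classical all_reals all_analysis.

Set Implicit Arguments.
Unset Strict Implicit.
Unset Printing Implicit Defensive.

Import Order.TTheory GRing.Theory Num.Theory.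

Local Open Scope classical_set_scope.
Local Open Scope ring_scope.

Section gelfand_topology.
Context (R : realType) (A : comFrechetAlgType R).

Lemma gelfand_continuous (a : A) : continuous (gelfand a).
Proof.
move=> phi; apply: (@continuous_comp (Delta A) {ptws A -> Cplx R} _ \val
  (fun f : {ptws A -> Cplx R} => f a)).
  exact: initial_continuous.
exact: (@proj_continuous A (fun=> Cplx R) a).
Qed.

(** The topology of [Delta A] is initial for the evaluations [gelfand a], so these detect
    convergence. *)
Lemma cvg_Delta (T : Type) (F : set_system T) {FF : Filter F}
    (f : T -> Delta A) (phi : Delta A) :
  (forall a, gelfand a (f t) @[t --> F] --> gelfand a phi) ->
  f @ F --> phi.
Proof.
move=> fphi U [_ [[W oW <-] Wphi WU]].
have val_cvg : {ptws, (fun t => \val (f t)) @ F --> (\val phi : A -> Cplx R)}.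
  by apply/pointwise_cvgP => a; exact: (fphi a).
apply: (@filterS _ F FF (fun t => W (\val (f t)))) => [t|]; first exact: WU.
exact: val_cvg (open_nbhs_nbhs (conj oW Wphi)).
Qed.

End gelfand_topology.

(* Abstracts the inclusions of [Delta A] and [Delta B] in [Delta (A ⊕ B)], so
   that [Delta_inl] and [Delta_inr] are treated together. *)
Section dual_map.
Context (R : realType) (C D : comFrechetAlgType R).
Variables (i : C -> D) (p : D -> C) (e : Delta C -> Delta D).
Hypothesis ip : cancel i p.
Hypothesis eE : forall d phi, gelfand d (e phi) = gelfand (p d) phi.

Lemma dual_map_continuous : continuous e.
Proof.
move=> phi; apply: (@cvg_Delta _ _ _ _ (nbhs_filter phi)) => d; rewrite eE.
by under eq_fun do rewrite eE; exact: gelfand_continuous.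
Qed.

(** Lift [c] to [i c]; if [d] represents the product with [Phi] over [D], then [p d] represents its
    pullback along [e]. *)
Lemma dual_map_multipliers Phi : multipliers D Phi -> multipliers C (Phi \o e).
Proof.
move=> [cPhi mPhi]; split.
  by move=> phi; apply: continuous_comp; [exact: dual_map_continuous|exact: cPhi].
move=> _ [_ [c _ <-] <-].
have [|d _ dE] := mPhi (Phi \* gelfand (i c)).
  by exists (gelfand (i c)) => //; exists (i c).
exists (p d) => //; apply/funext => phi /=.
by rewrite -eE dE /= eE ip.
Qed.

Hypothesis e_range : forall chi c, gelfand (i c) chi != 0 -> range e chi.

Lemma dual_map_open phi (U : set (Delta C)) :
  nbhs phi U -> nbhs (e phi) (e @` U).
Proof.
move=> phiU.
have [c phic] : exists c, gelfand c phi != 0.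
  by have := valP phi; rewrite inE => -[].
have near_range : \forall chi \near e phi, range e chi.
  have := cvgr_neq0 _ (@gelfand_continuous _ _ (i c) (e phi)).
  by rewrite eE ip => /(_ _ phic); apply: filterS => chi; exact: e_range.
(* [r] inverts [e] on its range; the default [phi] taken elsewhere is harmless, since the range is a
   neighbourhood of [e phi]. *)
pose r chi := xget phi [set phi' | e phi' = chi].
have er chi : range e chi -> e (r chi) = chi.
  by move=> [phi' _ phi'E]; apply: (@xgetI _ phi [set u | e u = chi] phi').
have r_cvg : r @ nbhs (e phi) --> phi.
  (* Near [e phi], evaluating [r chi] at [a] is evaluating [chi] at [i a], which is continuous in
     [chi]. *)
  apply: (@cvg_Delta _ _ _ _ (nbhs_filter (e phi))) => a; rewrite -{2}[a]ip -eE.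
  apply: cvg_trans (@gelfand_continuous _ _ (i a) (e phi)).
  apply: near_eq_cvg; apply: filterS near_range => chi /er {1}<-.
  by rewrite eE ip.
apply: filterS (filterI near_range (r_cvg _ phiU)) => chi [/er chiE rU].
by exists (r chi).
Qed.

End dual_map.

Section direct_sum.
Context (R : realType) (A B : comFrechetAlgType R).

Lemma gelfand_inl (x : A ⊕ B) (phi : Delta A) :
  gelfand x (Delta_inl B phi) = gelfand x.1 phi.
Proof. by rewrite /gelfand /= /pair_functional addr0. Qed.

Lemma gelfand_inr (x : A ⊕ B) (psi : Delta B) :
  gelfand x (Delta_inr A psi) = gelfand x.2 psi.
Proof. by rewrite /gelfand /= /pair_functional add0r. Qed.

(** A character coming from [B] sees only the zero coordinate of [(a, 0)]. *)
Lemma range_Delta_inl (chi : Delta (A ⊕ B)) (a : A) :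
  gelfand ((a, 0) : A ⊕ B) chi != 0 -> range (@Delta_inl R A B) chi.
Proof.
have [[phi ->]|[psi ->]] := Delta_direct_sum chi; first by exists phi.
by rewrite gelfand_inr /gelfand character0 eqxx.
Qed.

Lemma range_Delta_inr (chi : Delta (A ⊕ B)) (b : B) :
  gelfand ((0, b) : A ⊕ B) chi != 0 -> range (@Delta_inr R A B) chi.
Proof.
have [[phi ->]|[psi ->]] := Delta_direct_sum chi; last by exists psi.
by rewrite gelfand_inl /gelfand character0 eqxx.
Qed.

(** A neighbourhood within the piece containing [chi] is already one in the whole spectrum, by
    [dual_map_open]. *)
Lemma pairing_continuous (F : (Delta A -> Cplx R) * (Delta B -> Cplx R)) :
  continuous F.1 -> continuous F.2 -> continuous (pairing F).
Proof.
move=> cF1 cF2 chi.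
have [[phi ->]|[psi ->]] := Delta_direct_sum chi => U.
  rewrite pairing_inl => /cF1 phiU.
  have := dual_map_open (i := fun a : A => (a, 0) : A ⊕ B) (fun=> erefl)
    gelfand_inl range_Delta_inl phiU.
  by apply: filterS => _ [phi' ? <-]; rewrite /= pairing_inl.
rewrite pairing_inr => /cF2 psiU.
have := dual_map_open (i := fun b : B => (0, b) : A ⊕ B) (fun=> erefl)
  gelfand_inr range_Delta_inr psiU.
by apply: filterS => _ [psi' ? <-]; rewrite /= pairing_inr.
Qed.

Lemma pairing_multipliers (F : (Delta A -> Cplx R) * (Delta B -> Cplx R)) :
  multipliers A F.1 -> multipliers B F.2 -> multipliers (A ⊕ B) (pairing F).
Proof.
move=> [cF1 mF1] [cF2 mF2]; split; first exact: pairing_continuous.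
move=> _ [_ [[a b] _ <-] <-].
have [|c _ cE] := mF1 (F.1 \* gelfand a).
  by exists (gelfand a) => //; exists a.
have [|d _ dE] := mF2 (F.2 \* gelfand b).
  by exists (gelfand b) => //; exists b.
(* [c] and [d] can be chosen independently because each character sees only one coordinate. *)
exists ((c, d) : A ⊕ B) => //; apply/funext => chi /=.
have [[phi ->]|[psi ->]] := Delta_direct_sum chi.
  by rewrite pairing_inl !gelfand_inl /= cE.
by rewrite pairing_inr !gelfand_inr /= dE.
Qed.

End direct_sum.

Theorem proposition2p3 (R : realType) (A B : comFrechetAlgType R) :
  multipliers (A ⊕ B) = [set pairing F | F in multipliers A `*` multipliers B].
Proof.
apply/seteqP; split => [G mG|_ [F [mF1 mF2] <-]]; last exact: pairing_multipliers.
exists (G \o @Delta_inl R A B, G \o @Delta_inr R A B).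
  split.
    exact: (dual_map_multipliers (i := fun a : A => (a, 0) : A ⊕ B)
      (fun=> erefl) (@gelfand_inl R A B) mG).
  exact: (dual_map_multipliers (i := fun b : B => (0, b) : A ⊕ B)
    (fun=> erefl) (@gelfand_inr R A B) mG).
apply/funext => chi.
by have [[phi ->]|[psi ->]] := Delta_direct_sum chi; rewrite ?pairing_inl ?pairing_inr.
Qed.
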